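(* Let $\theta\in\mathbb{R}$ and let $n$ be a positive integer. With the notation of the context, the module of coequivariant maps $\mathrm{Hom}_{\rho_n}(V^{(n)},\mathcal{A}(S^7_{\theta'}))$ is isomorphic, as a right $\mathcal{A}(S^4_\theta)$-module, to $\Gamma(S^4_\theta,E^{(n)}):=p_{(n)}\big(\mathcal{A}(S^4_\theta)^{4^n}\big)$, the isomorphism being given explicitly by $$\Gamma(S^4_\theta,E^{(n)})\ \ni\ \sigma_{(n)}=p_{(n)}|f\rangle\ \longleftrightarrow\ \phi_{(n)}:\ e_k\mapsto\langle\phi_k|f\rangle,\qquad |f\rangle\in\mathcal{A}(S^4_\theta)^{4^n},\ k=1,\dots,n+1.$$
   Context: Let $\lambda=e^{2\pi i\theta}$, $\mu=\sqrt\lambda=e^{\pi i\theta}$. $\mathcal{A}(S^7_{\theta'})$ is the unital complex $*$-algebra generated by $z^1,\dots,z^4$ and $\bar z^i=(z^i)^*$, with relations $z^iz^j=\lambda'^{ij}z^jz^i$, $\bar z^iz^j=\lambda'^{ji}z^j\bar z^i$, $\bar z^i\bar z^j=\lambda'^{ij}\bar z^j\bar z^i$ and $\sum_iz^i\bar z^i=1$, where $\lambda'^{ij}=1$ for $i,j\in\{1,2\}$ or $i,j\in\{3,4\}$, $\lambda'^{ij}=\mu$ for $i\in\{1,2\},j\in\{3,4\}$, and $\lambda'^{ij}=\bar\mu$ for $i\in\{3,4\},j\in\{1,2\}$. For $w=\begin{pmatrix}w^1&w^2\\-\bar w^2&\bar w^1\end{pmatrix}\in SU(2)$, $\alpha_w$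 is the $*$-automorphism of $\mathcal{A}(S^7_{\theta'})$ given by $(z^1,z^2,z^3,z^4)\mapsto(z^1,z^2,z^3,z^4)\begin{pmatrix}w&0\\0&w\end{pmatrix}$. The algebra $\mathcal{A}(S^4_\theta)$ is identified with the subalgebra of $SU(2)$-invariant elements of $\mathcal{A}(S^7_{\theta'})$; it is generated as a $*$-algebra by $\alpha=2(z^1\bar z^3+z^2\bar z^4)$, $\beta=2(-z^1z^4+z^2z^3)$, $x=z^1\bar z^1+z^2\bar z^2-z^3\bar z^3-z^4\bar z^4$. Kets. On $\mathcal{A}(S^7_{\theta'})^N$ use the hermitian structure $\langle\xi|\eta\rangle=\sum_j\xi_j^*\eta_j$; $\langle\xi|$ is the dual of $|\xi\rangle$. Tensor products of kets have components $(|\xi\rangle\otimes|\eta\rangle)_{ij}=\xi_i\eta_j$. Put $|\psi_1\rangle=(z^1,-\bar z^2,z^3,-\bar z^4)^t$, $|\psi_2\rangle=(z^2,\bar z^1,z^4,\bar z^3)^t$, and for $k=1,\dots,n+1$ $$|\phi_k\rangle=\frac1{a_k}|\psi_1\rangle^{\otimes(n-k+1)}\otimes_S|\psi_2\rangle^{\otimes(k-1)}\in\mathcal{A}(S^7_{\theta'})^{4^n},\qquad a_k^2=\binom{n}{k-1},\ a_k>0,$$ where $\otimes_S$ denotes the sum over all $\binom{n}{k-1}$ distinct orderings of the $n$ tensor factors. One has $\langle\phi_k|\phi_l\rangle=\delta_{kl}$, and $p_{(n)}=\sum_{k=1}^{n+1}|\phi_k\rangle\langle\phi_k|$ is a projection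 in $\mathrm{Mat}_{4^n}(\mathcal{A}(S^4_\theta))$. Representations and coequivariant maps. $V^{(n)}=\mathrm{Sym}^n(\mathbb{C}^2)$ carries the irreducible representation $\rho_n$ of $SU(2)$ (the restriction of $w^{\otimes n}$ to symmetric tensors), and $e_1,\dots,e_{n+1}$ is the orthonormal basis $e_k=a_k^{-1}\,\epsilon_1^{\otimes(n-k+1)}\otimes_S\epsilon_2^{\otimes(k-1)}$, where $\epsilon_1,\epsilon_2$ is the canonical basis of $\mathbb{C}^2$. Let $\rho_n(w)_{kl}$ be the matrix entries, $\rho_n(w)e_l=\sum_k\rho_n(w)_{kl}e_k$. The space $\mathrm{Hom}_{\rho_n}(V^{(n)},\mathcal{A}(S^7_{\theta'}))$ of coequivariant maps consists of the linear maps $\phi:V^{(n)}\to\mathcal{A}(S^7_{\theta'})$ with $$\sum_{l}\rho_n(w^{-1})_{kl}\,\phi(e_l)=\alpha_w(\phi(e_k))\qquad\text{for all } w\in SU(2),\ k=1,\dots,n+1.$$ It is a right $\mathcal{A}(S^4_\theta)$-module via $(\phi a)(v)=\phi(v)a$. *)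

(* Defs.v *)
From HB Require Import structures.
From mathcomp Require Import all_boot all_order all_algebra all_fingroup.
From mathcomp Require Import spectral.
From mathcomp Require Import generic_quotient.
From mathcomp Require Import complex.
From mathcomp Require Import boolp functions reals trigo.

Set Implicit Arguments.
Unset Strict Implicit.
Unset Printing Implicit Defensive.

Import Order.TTheory GRing.Theory Num.Theory.

Local Open Scope ring_scope.
Local Open Scope quotient_scope.

Section Deformation.
Variables (R : realType) (theta : R).

Definition mu : R[i] := (cos (pi * theta) +i* sin (pi * theta))%C.

(* Indices are shifted by one: the generator z^i is indexed by i - 1 : 'I_4. *)
Definition lam (i j : 'I_4) : R[i] :=
  if (i < 2)%N == (j < 2)%N then 1 else if (i < 2)%N then mu else mu^*.

End Deformation.

(* A(S^7) is built as formal *-algebra expressions in four generators, modulo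
   the least congruence containing the unital complex *-algebra laws and the
   defining relations. *)
Inductive S7term (R : realType) : Type :=
| Tgen of 'I_4
| Tzero
| Tone
| Tadd of S7term R & S7term R
| Topp of S7term R
| Tmul of S7term R & S7term R
| Tscale of R[i] & S7term R
| Tstar of S7term R.
Arguments Tgen {R} _.
Arguments Tzero {R}.
Arguments Tone {R}.

Inductive S7eqv (R : realType) (theta : R) : S7term R -> S7term R -> Prop :=
| E_refl a : S7eqv theta a a
| E_sym a b : S7eqv theta a b -> S7eqv theta b a
| E_trans a b c : S7eqv theta a b -> S7eqv theta b c -> S7eqv theta a c
| E_add a a' b b' : S7eqv theta a a' -> S7eqv theta b b' ->
    S7eqv theta (Tadd a b) (Tadd a' b')
| E_opp a a' : S7eqv theta a a' -> S7eqv theta (Topp a) (Topp a')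
| E_mul a a' b b' : S7eqv theta a a' -> S7eqv theta b b' ->
    S7eqv theta (Tmul a b) (Tmul a' b')
| E_scale k a a' : S7eqv theta a a' -> S7eqv theta (Tscale k a) (Tscale k a')
| E_star a a' : S7eqv theta a a' -> S7eqv theta (Tstar a) (Tstar a')
| E_addA a b c : S7eqv theta (Tadd a (Tadd b c)) (Tadd (Tadd a b) c)
| E_addC a b : S7eqv theta (Tadd a b) (Tadd b a)
| E_add0 a : S7eqv theta (Tadd Tzero a) a
| E_addN a : S7eqv theta (Tadd (Topp a) a) Tzero
| E_mulA a b c : S7eqv theta (Tmul a (Tmul b c)) (Tmul (Tmul a b) c)
| E_mul1l a : S7eqv theta (Tmul Tone a) a
| E_mul1r a : S7eqv theta (Tmul a Tone) a
| E_mulDl a b c :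
    S7eqv theta (Tmul (Tadd a b) c) (Tadd (Tmul a c) (Tmul b c))
| E_mulDr a b c :
    S7eqv theta (Tmul a (Tadd b c)) (Tadd (Tmul a b) (Tmul a c))
| E_scaleA k l a : S7eqv theta (Tscale k (Tscale l a)) (Tscale (k * l) a)
| E_scale1 a : S7eqv theta (Tscale 1 a) a
| E_scaleDr k a b :
    S7eqv theta (Tscale k (Tadd a b)) (Tadd (Tscale k a) (Tscale k b))
| E_scaleDl k l a :
    S7eqv theta (Tscale (k + l) a) (Tadd (Tscale k a) (Tscale l a))
| E_scaleAl k a b : S7eqv theta (Tscale k (Tmul a b)) (Tmul (Tscale k a) b)
| E_scaleAr k a b : S7eqv theta (Tscale k (Tmul a b)) (Tmul a (Tscale k b))
| E_starD a b : S7eqv theta (Tstar (Tadd a b)) (Tadd (Tstar a) (Tstar b))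
| E_starM a b : S7eqv theta (Tstar (Tmul a b)) (Tmul (Tstar b) (Tstar a))
| E_starZ k a : S7eqv theta (Tstar (Tscale k a)) (Tscale k^* (Tstar a))
| E_starK a : S7eqv theta (Tstar (Tstar a)) a
| E_zz i j :
    S7eqv theta (Tmul (Tgen i) (Tgen j))
      (Tscale (lam theta i j) (Tmul (Tgen j) (Tgen i)))
| E_czz i j :
    S7eqv theta (Tmul (Tstar (Tgen i)) (Tgen j))
      (Tscale (lam theta j i) (Tmul (Tgen j) (Tstar (Tgen i))))
| E_czcz i j :
    S7eqv theta (Tmul (Tstar (Tgen i)) (Tstar (Tgen j)))
      (Tscale (lam theta i j) (Tmul (Tstar (Tgen j)) (Tstar (Tgen i))))
| E_sphere :
    S7eqv theta
      (\big[@Tadd R/Tzero]_(i < 4) Tmul (Tgen i) (Tstar (Tgen i))) Tone.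

HB.instance Definition _ (R : realType) := gen_eqMixin (S7term R).
HB.instance Definition _ (R : realType) := gen_choiceMixin (S7term R).

(* The universal property: a family b in a *-algebra (B, st) satisfying the
   defining relations extends along Tgen. *)
Section Evaluation.
Variables (R : realType) (theta : R) (B : algType R[i]).
Variables (st : B -> B) (b : 'I_4 -> B).

Fixpoint S7eval (t : S7term R) : B :=
  match t with
  | Tgen i => b i
  | Tzero => 0
  | Tone => 1
  | Tadd s t => S7eval s + S7eval t
  | Topp s => - S7eval s
  | Tmul s t => S7eval s * S7eval t
  | Tscale k s => k *: S7eval s
  | Tstar s => st (S7eval s)
  end.

Record is_star : Prop := IsStar {
  is_starD : forall x y, st (x + y) = st x + st y;
  is_starM : forall x y, st (x * y) = st y * st x;
  is_starZ : forall k x, st (k *: x) = k^* *: st x;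
  is_starK : forall x, st (st x) = x }.

Record S7rel : Prop := IsS7rel {
  S7rel_zz : forall i j, b i * b j = lam theta i j *: (b j * b i);
  S7rel_czz : forall i j, st (b i) * b j = lam theta j i *: (b j * st (b i));
  S7rel_czcz : forall i j,
    st (b i) * st (b j) = lam theta i j *: (st (b j) * st (b i));
  S7rel_sphere : \sum_i b i * st (b i) = 1 }.

Hypotheses (stP : is_star) (bP : S7rel).

Lemma S7eval_eqv (s t : S7term R) : S7eqv theta s t -> S7eval s = S7eval t.
Proof.
elim=> {s t} /=; do ?[by move=> *; congruence].
- by move=> *; rewrite addrA.
- by move=> *; rewrite addrC.
- by move=> *; rewrite add0r.
- by move=> *; rewrite addNr.
- by move=> *; rewrite mulrA.
- by move=> *; rewrite mul1r.
- by move=> *; rewrite mulr1.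
- by move=> *; rewrite mulrDl.
- by move=> *; rewrite mulrDr.
- by move=> *; rewrite scalerA.
- by move=> *; rewrite scale1r.
- by move=> *; rewrite scalerDr.
- by move=> *; rewrite scalerDl.
- by move=> *; rewrite scalerAl.
- by move=> *; rewrite scalerAr.
- by move=> *; rewrite (is_starD stP).
- by move=> *; rewrite (is_starM stP).
- by move=> *; rewrite (is_starZ stP).
- by move=> *; rewrite (is_starK stP).
- exact: S7rel_zz.
- exact: S7rel_czz.
- exact: S7rel_czcz.
- rewrite -(S7rel_sphere bP).
  by rewrite (big_morph S7eval (op1 := +%R) (id1 := 0)).
Qed.

End Evaluation.

Section Quotient.
Variables (R : realType) (theta : R).

Definition S7eqvb : rel (S7term R) := fun s t => `[< S7eqv theta s t >].

Lemma S7eqvb_refl : reflexive S7eqvb.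
Proof. by move=> s; apply/asboolP; exact: E_refl. Qed.
Lemma S7eqvb_sym : symmetric S7eqvb.
Proof. by move=> s t; apply/asboolP/asboolP; exact: E_sym. Qed.
Lemma S7eqvb_trans : transitive S7eqvb.
Proof.
by move=> t s u /asboolP st /asboolP tu; apply/asboolP; exact: E_trans tu.
Qed.

Canonical S7eqvb_equiv := EquivRel S7eqvb S7eqvb_refl S7eqvb_sym S7eqvb_trans.

Definition S7 : Type := {eq_quot S7eqvb}.
HB.instance Definition _ := Choice.on S7.
HB.instance Definition _ := EqQuotient.on S7.

Definition S7class (t : S7term R) : S7 := \pi_S7 t.

Lemma S7classP (s t : S7term R) : S7eqv theta s t <-> S7class s = S7class t.
Proof. by split=> [/asboolP st|/eqmodP/asboolP]; [apply/eqmodP|]. Qed.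

Lemma S7class_repr (x : S7) : S7class (repr x) = x.
Proof. exact: reprK. Qed.

Definition S7add (x y : S7) := S7class (Tadd (repr x) (repr y)).
Definition S7opp (x : S7) := S7class (Topp (repr x)).
Definition S7mul (x y : S7) := S7class (Tmul (repr x) (repr y)).
Definition S7scale (k : R[i]) (x : S7) := S7class (Tscale k (repr x)).
Definition S7star (x : S7) : S7 := S7class (Tstar (repr x)).
Definition zgen (i : 'I_4) : S7 := S7class (Tgen i).

Lemma S7repr_class t : S7eqv theta (repr (S7class t)) t.
Proof. by apply/S7classP; rewrite S7class_repr. Qed.

Lemma S7addE s t : S7add (S7class s) (S7class t) = S7class (Tadd s t).
Proof. by apply/S7classP/E_add; exact: S7repr_class. Qed.
Lemma S7oppE s : S7opp (S7class s) = S7class (Topp s).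
Proof. by apply/S7classP/E_opp; exact: S7repr_class. Qed.
Lemma S7mulE s t : S7mul (S7class s) (S7class t) = S7class (Tmul s t).
Proof. by apply/S7classP/E_mul; exact: S7repr_class. Qed.
Lemma S7scaleE k s : S7scale k (S7class s) = S7class (Tscale k s).
Proof. by apply/S7classP/E_scale; exact: S7repr_class. Qed.
Lemma S7starE s : S7star (S7class s) = S7class (Tstar s).
Proof. by apply/S7classP/E_star; exact: S7repr_class. Qed.

Lemma S7_ind (P : S7 -> Prop) : (forall t, P (S7class t)) -> forall x, P x.
Proof. by move=> Pt x; rewrite -(S7class_repr x). Qed.

Let addA : associative S7add.
Proof.
elim/S7_ind=> a; elim/S7_ind=> b; elim/S7_ind=> c.
by rewrite !S7addE; apply/S7classP; constructor.
Qed.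
Let addC : commutative S7add.
Proof.
elim/S7_ind=> a; elim/S7_ind=> b.
by rewrite !S7addE; apply/S7classP/E_addC.
Qed.
Let add0 : left_id (S7class Tzero) S7add.
Proof. by elim/S7_ind=> a; rewrite S7addE; apply/S7classP; constructor. Qed.
Let addN : left_inverse (S7class Tzero) S7opp S7add.
Proof.
by elim/S7_ind=> a; rewrite S7oppE S7addE; apply/S7classP; constructor.
Qed.

HB.instance Definition _ := GRing.isZmodule.Build S7 addA addC add0 addN.

Let mulA : associative S7mul.
Proof.
elim/S7_ind=> a; elim/S7_ind=> b; elim/S7_ind=> c.
by rewrite !S7mulE; apply/S7classP; constructor.
Qed.
Let mul1l : left_id (S7class Tone) S7mul.
Proof. by elim/S7_ind=> a; rewrite S7mulE; apply/S7classP; constructor. Qed.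
Let mul1r : right_id (S7class Tone) S7mul.
Proof. by elim/S7_ind=> a; rewrite S7mulE; apply/S7classP; constructor. Qed.
Let mulDl : left_distributive S7mul +%R.
Proof.
elim/S7_ind=> a; elim/S7_ind=> b; elim/S7_ind=> c.
by rewrite [X in S7mul X _]S7addE !S7mulE [RHS]S7addE;
   apply/S7classP; constructor.
Qed.
Let mulDr : right_distributive S7mul +%R.
Proof.
elim/S7_ind=> a; elim/S7_ind=> b; elim/S7_ind=> c.
by rewrite [X in S7mul _ X]S7addE !S7mulE [RHS]S7addE;
   apply/S7classP; constructor.
Qed.

(* The point (1, 0, 0, 0) is a character of A(S^7). *)
Let pt (i : 'I_4) : R[i]^o := (i == 0)%:R.

Let star_conj : is_star (Num.conj : R[i]^o -> R[i]^o).
Proof.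
split=> [x y|x y|k x|x]; first exact: rmorphD.
- by rewrite rmorphM mulrC.
- exact: rmorphM.
- exact: conjCK.
Qed.

Let pt_rel : S7rel theta (Num.conj : R[i]^o -> R[i]^o) pt.
Proof.
have ptC i : (pt i)^* = pt i by exact: conjC_nat.
have ptM i j : pt i * pt j = lam theta i j *: (pt j * pt i).
  have [->|i0] := eqVneq i j; first by rewrite /lam eqxx scale1r.
  rewrite /pt; have [i1|_] := boolP (i == 0); last by rewrite !(mul0r, mulr0, scaler0).
  have [j1|_] := boolP (j == 0); last by rewrite !(mul0r, mulr0, scaler0).
  by rewrite (eqP i1) (eqP j1) eqxx in i0.
split=> [i j|i j|i j|]; rewrite ?ptC //.
- by rewrite [LHS]mulrC [X in _ *: X]mulrC; exact: ptM.
- by rewrite !big_ord_recl big_ord0 !ptC /pt /= !mulr0 !addr0 mulr1.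
Qed.

Let one_neq0 : S7class Tone != 0.
Proof.
apply/eqP=> /S7classP/(S7eval_eqv star_conj pt_rel)/eqP.
by rewrite oner_eq0.
Qed.

HB.instance Definition _ :=
  GRing.Zmodule_isNzRing.Build S7 mulA mul1l mul1r mulDl mulDr one_neq0.

Let scaleA k l x : S7scale k (S7scale l x) = S7scale (k * l) x.
Proof. by elim/S7_ind: x => a; rewrite !S7scaleE; apply/S7classP; constructor. Qed.
Let scale1 : left_id 1 S7scale.
Proof. by elim/S7_ind=> a; rewrite S7scaleE; apply/S7classP; constructor. Qed.
Let scaleDr : right_distributive S7scale +%R.
Proof.
move=> k; elim/S7_ind=> a; elim/S7_ind=> b.
by rewrite [X in S7scale _ X]S7addE !S7scaleE [RHS]S7addE;
   apply/S7classP; constructor.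
Qed.
Let scaleDl x : {morph S7scale^~ x : k l / k + l}.
Proof.
move=> k l; elim/S7_ind: x => a.
by rewrite !S7scaleE [RHS]S7addE; apply/S7classP; constructor.
Qed.

HB.instance Definition _ :=
  GRing.Zmodule_isLmodule.Build R[i] S7 scaleA scale1 scaleDr scaleDl.

Let scaleAl (k : R[i]) (x y : S7) : k *: (x * y) = (k *: x) * y.
Proof.
elim/S7_ind: x => a; elim/S7_ind: y => b.
by rewrite [_ * _]S7mulE ![_ *: _]S7scaleE [RHS]S7mulE;
   apply/S7classP; constructor.
Qed.

HB.instance Definition _ := GRing.Lmodule_isLalgebra.Build R[i] S7 scaleAl.

Let scaleAr (k : R[i]) (x y : S7) : k *: (x * y) = x * (k *: y).
Proof.
elim/S7_ind: x => a; elim/S7_ind: y => b.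
by rewrite [_ * _]S7mulE ![_ *: _]S7scaleE [RHS]S7mulE;
   apply/S7classP; constructor.
Qed.

HB.instance Definition _ := GRing.Lalgebra_isAlgebra.Build R[i] S7 scaleAr.

Lemma S7starP : is_star S7star.
Proof.
split=> [|||]; do ?[by elim/S7_ind=> a; rewrite !S7starE; apply/S7classP; constructor].
- elim/S7_ind=> a; elim/S7_ind=> b.
  rewrite [_ + _]S7addE !S7starE [RHS]S7addE; exact/S7classP/E_starD.
- elim/S7_ind=> a; elim/S7_ind=> b.
  rewrite [_ * _]S7mulE !S7starE [RHS]S7mulE; exact/S7classP/E_starM.
- move=> k; elim/S7_ind=> a.
  rewrite [_ *: _]S7scaleE !S7starE [RHS]S7scaleE; exact/S7classP/E_starZ.
Qed.

Lemma zgen_rel : S7rel theta S7star zgen.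
Proof.
split=> [i j|i j|i j|]; rewrite ?S7starE.
- by rewrite ![_ * _]S7mulE [RHS]S7scaleE; apply/S7classP; constructor.
- by rewrite ![_ * _]S7mulE [RHS]S7scaleE; apply/S7classP; constructor.
- by rewrite ![_ * _]S7mulE [RHS]S7scaleE; apply/S7classP; constructor.
- transitivity (S7class (\big[@Tadd R/Tzero]_(i < 4) Tmul (Tgen i) (Tstar (Tgen i)))).
    rewrite (big_morph S7class (op1 := +%R) (id1 := 0)) //.
      by apply: eq_bigr => i _; rewrite S7starE [LHS]S7mulE.
    by move=> s t; rewrite [RHS]S7addE.
  by apply/S7classP; constructor.
Qed.

Definition S7lift (B : algType R[i]) (st : B -> B) (b : 'I_4 -> B) (x : S7) : B :=
  S7eval st b (repr x).

Section Lift.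
Variables (B : algType R[i]) (st : B -> B) (b : 'I_4 -> B).
Hypotheses (stP : is_star st) (bP : S7rel theta st b).

Lemma S7liftE t : S7lift st b (S7class t) = S7eval st b t.
Proof. by apply: (S7eval_eqv stP bP); exact: S7repr_class. Qed.

Lemma S7lift_is_linear : linear (S7lift st b).
Proof.
move=> k; elim/S7_ind=> x; elim/S7_ind=> y.
by rewrite [_ *: _]S7scaleE [_ + _]S7addE !S7liftE.
Qed.

Lemma S7lift_is_monoid_morphism : monoid_morphism (S7lift st b).
Proof.
split; first by rewrite [LHS]S7liftE.
by elim/S7_ind=> x; elim/S7_ind=> y; rewrite [_ * _]S7mulE !S7liftE.
Qed.

Lemma S7lift_star x : S7lift st b (S7star x) = st (S7lift st b x).
Proof. by elim/S7_ind: x => x; rewrite S7starE !S7liftE. Qed.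

Lemma S7lift_gen i : S7lift st b (zgen i) = b i.
Proof. exact: S7liftE. Qed.

End Lift.

End Quotient.

Record SU2 (R : realType) := MkSU2 {
  su2_mx :> 'M[R[i]]_2;
  su2_unitary : su2_mx \is unitarymx;
  su2_det : \det su2_mx = 1 }.

Section Action.
Variables (R : realType) (theta : R).
Local Notation A := (S7 theta).
Local Notation "x ^star" := (S7star x) (at level 2, format "x ^star").
Local Notation z := (zgen theta).

Definition diag2 (w : 'M[R[i]]_2) : 'M[R[i]]_4 :=
  (block_mx w 0 0 w : 'M[R[i]]_(2 + 2)).

(* (z^1, ..., z^4) diag(w, w) *)
Definition zact (w : 'M[R[i]]_2) (j : 'I_4) : A :=
  \sum_(i < 4) diag2 w i j *: z i.

(* alpha_w is the extension of zact w; see alpha_gen and alpha_star. *)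
Definition alpha (w : SU2 R) : A -> A := S7lift (@S7star R theta) (zact w).

Lemma diag2_lam (w : 'M[R[i]]_2) (i j : 'I_4) :
  (i < 2)%N != (j < 2)%N -> diag2 w i j = 0.
Proof.
have E (k : 'I_4) : k = match fintype.split (k : 'I_(2 + 2)) with
    inl l => lshift 2 l | inr r => rshift 2 r end.
  by rewrite -{1}[k](@splitK 2 2); case: fintype.split.
rewrite (E i) (E j); case: fintype.split => i'; case: fintype.split => j'; rewrite /diag2.
- by rewrite /= !ltn_ord.
- move=> _; transitivity ((0 : 'M[R[i]]_2) i' j'); last by rewrite mxE.
  exact: (@block_mxEur _ 2 2 2 2 w 0 0 w i' j').
- move=> _; transitivity ((0 : 'M[R[i]]_2) i' j'); last by rewrite mxE.
  exact: (@block_mxEdl _ 2 2 2 2 w 0 0 w i' j').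
- by [].
Qed.

Lemma diag2_unitary (w : SU2 R) k l :
  \sum_i diag2 w k i * (diag2 w l i)^* = (k == l)%:R.
Proof.
have U : (block_mx w 0 0 w : 'M[R[i]]_(2 + 2)) \is unitarymx.
  apply/unitarymxP; rewrite tr_block_mx map_block_mx mulmx_block.
  rewrite !raddf0 /= !(mul0mx, mulmx0) !(map_mx0, mul0mx, mulmx0, addr0, add0r).
  by rewrite (unitarymxP (su2_unitary w)) -scalar_mx_block.
have /unitarymxP/matrixP/(_ k l) := U.
rewrite !mxE => <-; apply: eq_bigr => i _; by rewrite !mxE.
Qed.

Let stE := (is_starD (@S7starP R theta), is_starM (@S7starP R theta),
            is_starZ (@S7starP R theta), is_starK (@S7starP R theta)).

Lemma S7star0 : S7star (0 : A) = 0.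
Proof. by rewrite -[X in S7star X](scale0r 0) stE conjC0 scale0r. Qed.

Lemma S7star_sum (I : Type) (r : seq I) (P : pred I) (F : I -> A) :
  S7star (\sum_(i <- r | P i) F i) = \sum_(i <- r | P i) S7star (F i).
Proof.
apply: (big_morph (@S7star R theta)); last exact: S7star0.
by move=> x y; rewrite stE.
Qed.

Let lam_block (w : 'M[R[i]]_2) i j k l :
  diag2 w k i != 0 -> diag2 w l j != 0 -> lam theta i j = lam theta k l.
Proof.
move=> ki lj.
have /eqP Ek : (k < 2)%N == (i < 2)%N by apply: contraNT ki => /diag2_lam ->.
have /eqP El : (l < 2)%N == (j < 2)%N by apply: contraNT lj => /diag2_lam ->.
by rewrite /lam Ek El.
Qed.

Lemma zact_rel (w : SU2 R) : S7rel theta (@S7star R theta) (zact w).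
Proof.
have zr := zgen_rel theta.
have stz i : (zact w i)^star = \sum_k (diag2 w k i)^* *: (z k)^star.
  by rewrite S7star_sum; apply: eq_bigr => k _; rewrite stE.
have key (c c' : 'I_4 -> R[i]) (x y : 'I_4 -> A) q :
    (forall k l, c k != 0 -> c' l != 0 -> x k * y l = q *: (y l * x k)) ->
  (\sum_k c k *: x k) * (\sum_l c' l *: y l) =
     q *: ((\sum_l c' l *: y l) * (\sum_k c k *: x k)).
  move=> xy; rewrite !big_distrlr /= [in RHS]exchange_big scaler_sumr.
  apply: eq_bigr => k _; rewrite scaler_sumr; apply: eq_bigr => l _.
  have [->|ck] := eqVneq (c k) 0; first by rewrite !(scale0r, mul0r, mulr0, scaler0).
  have [->|cl] := eqVneq (c' l) 0; first by rewrite !(scale0r, mul0r, mulr0, scaler0).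
  rewrite -!(scalerAl, scalerAr) xy // !scalerA; congr (_ *: _).
  by rewrite mulrC -mulrA [c k * _]mulrC.
split=> [i j|i j|i j|].
- by apply: key => k l ki lj; rewrite (lam_block ki lj) (S7rel_zz zr).
- rewrite stz; apply: key => k l; rewrite conjC_eq0 => ki lj.
  by rewrite (lam_block lj ki) (S7rel_czz zr).
- rewrite !stz; apply: key => k l; rewrite !conjC_eq0 => ki lj.
  by rewrite (lam_block ki lj) (S7rel_czcz zr).
- transitivity (\sum_k \sum_l (\sum_i diag2 w k i * (diag2 w l i)^*)
                 *: (z k * (z l)^star)).
    rewrite (eq_bigr (fun i => \sum_k \sum_l
      (diag2 w k i * (diag2 w l i)^*) *: (z k * (z l)^star))) => [|i _].
      rewrite exchange_big; apply: eq_bigr => k _.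
      by rewrite exchange_big; apply: eq_bigr => l _; rewrite scaler_suml.
    rewrite stz big_distrlr /=; apply: eq_bigr => k _; apply: eq_bigr => l _.
    by rewrite -scalerAl -scalerAr scalerA.
  rewrite -[RHS](S7rel_sphere zr); apply: eq_bigr => k _.
  rewrite (bigD1 k) //= diag2_unitary eqxx scale1r big1 ?addr0 // => l lk.
  by rewrite diag2_unitary eq_sym (negPf lk) scale0r.
Qed.

HB.instance Definition _ (w : SU2 R) :=
  GRing.isLinear.Build R[i] A A _ (alpha w)
    (S7lift_is_linear (@S7starP R theta) (zact_rel w)).
HB.instance Definition _ (w : SU2 R) :=
  GRing.isMonoidMorphism.Build A A (alpha w)
    (S7lift_is_monoid_morphism (@S7starP R theta) (zact_rel w)).

Lemma alpha_gen (w : SU2 R) j : alpha w (z j) = \sum_i diag2 w i j *: z i.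
Proof. exact: (S7lift_gen (@S7starP R theta) (zact_rel w)). Qed.

Lemma alpha_star (w : SU2 R) a : alpha w a^star = (alpha w a)^star.
Proof. exact: (S7lift_star (@S7starP R theta) (zact_rel w)). Qed.

(* A(S^4) is identified with the subalgebra of SU(2)-invariants of A(S^7). *)
Definition S4pred : {pred A} := fun a => `[< forall w, alpha w a = a >].

Lemma S4pred_subalg : GRing.subsemialg_closed S4pred.
Proof.
split=> [||k x /asboolP fx|x y /asboolP fx /asboolP fy].
- by apply/asboolP=> w; rewrite rmorph1.
- split; first by apply/asboolP=> w; rewrite raddf0.
  by move=> x y /asboolP fx /asboolP fy; apply/asboolP=> w; rewrite raddfD /= fx fy.
- by apply/asboolP=> w; rewrite linearZ /= fx.
- by apply/asboolP=> w; rewrite rmorphM /= fx fy.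
Qed.

Lemma S4pred_star a : a \in S4pred -> a^star \in S4pred.
Proof. by move/asboolP=> fa; apply/asboolP=> w; rewrite alpha_star fa. Qed.

Record S4 : predArgType := MkS4 { S4val :> A; S4valP : S4val \in S4pred }.

HB.instance Definition _ := [isSub for S4val].
HB.instance Definition _ := [Choice of S4 by <:].
HB.instance Definition _ :=
  GRing.SubChoice_isSubAlgebra.Build R[i] A S4pred S4 S4pred_subalg.

End Action.

(* Elements of (T^d)^(tensor n), by their components. *)
Notation tens d n T := {ffun {ffun 'I_n -> 'I_d} -> T}.

(* u^(tensor (n - k)) tensor_S v^(tensor k): the orderings of the factors are
   indexed by the set s of positions occupied by v. *)
Definition otimesS (T : pzSemiRingType) (d n k : nat) (u v : 'I_d -> T) :
    tens d n T :=
  [ffun i : {ffun 'I_n -> 'I_d} =>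
     \sum_(s : {set 'I_n} | #|s| == k)
       \prod_(m < n) (if m \in s then v (i m) else u (i m))].

Section Representation.
Variables (R : realType) (n : nat).
Local Notation T := (tens 2 n R[i]^o).

Definition permute (s : 'S_n) (t : T) : T :=
  [ffun i : {ffun 'I_n -> 'I_2} => t [ffun m => i (s m)]].

Lemma permute_is_linear s : linear (permute s).
Proof. by move=> k t u; apply/ffunP=> i; rewrite !ffunE. Qed.
HB.instance Definition _ s :=
  GRing.isLinear.Build R[i] T T _ (permute s) (permute_is_linear s).

Definition Sym : {vspace T} :=
  (\bigcap_(s : 'S_n) fixedSpace (linfun (permute s)))%VS.

Lemma mem_Sym t : reflect (forall s, permute s t = t) (t \in Sym).
Proof.
rewrite memvE; apply: (iffP subv_bigcapP) => [H s|H s _].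
  by move: (H s isT); rewrite -memvE => /fixedSpaceP; rewrite lfunE.
by rewrite -memvE; apply/fixedSpaceP; rewrite lfunE /= H.
Qed.

Definition V := subvs_of Sym.

(* w^(tensor n) *)
Definition tpow (w : 'M[R[i]]_2) (t : T) : T :=
  [ffun i : {ffun 'I_n -> 'I_2} =>
     \sum_(j : {ffun 'I_n -> 'I_2}) (\prod_(m < n) w (i m) (j m)) * t j].

Lemma tpow_Sym w t : t \in Sym -> tpow w t \in Sym.
Proof.
move=> /mem_Sym tS; apply/mem_Sym => s; apply/ffunP=> i; rewrite !ffunE.
have bij : bijective (fun j : {ffun 'I_n -> 'I_2} => [ffun m => j (s m)]).
  by exists (fun j : {ffun 'I_n -> 'I_2} => [ffun m => j ((s^-1)%g m)]) => j; apply/ffunP=> m;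
     rewrite !ffunE ?permK ?permKV.
rewrite (reindex _ (onW_bij _ bij)) /=; apply: eq_bigr => j _.
rewrite -{2}(tS s) ffunE; congr (_ * _).
by rewrite [RHS](reindex_inj (@perm_inj _ s)); apply: eq_bigr => m _; rewrite !ffunE.
Qed.

Definition rho (w : 'M[R[i]]_2) (v : V) : V := Subvs (tpow_Sym w (subvsP v)).

(* The normalisation a_k, with k shifted by one. *)
Definition acoef (k : nat) : R[i] := sqrtC 'C(n, k)%:R.

(* e_k, with k shifted by one. *)
Definition eT (k : nat) : T :=
  (acoef k)^-1 *: otimesS n k (fun a : 'I_2 => (a == 0)%:R : R[i]^o)
                              (fun a => (a == 1)%:R).

Lemma eT_Sym k : eT k \in Sym.
Proof.
apply/mem_Sym => s; apply/ffunP=> i; rewrite !ffunE; congr (_ * _).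
rewrite (reindex_inj (@imset_inj _ _ (s^-1)%g perm_inj)) /=.
apply: eq_big => [S|S _]; first by rewrite card_imset //; exact: perm_inj.
rewrite [RHS](reindex_inj (@perm_inj _ s)) /=; apply: eq_bigr => m _.
rewrite !ffunE; suff -> : (m \in (s^-1)%g @: S) = (s m \in S) by [].
by rewrite -{1}(permK s m) mem_imset //; exact: perm_inj.
Qed.

Definition e (k : nat) : V := Subvs (eT_Sym k).

Definition rho_mx (w : 'M[R[i]]_2) : 'M[R[i]]_n.+1 :=
  \matrix_(k, l) coord [tuple e i | i < n.+1] k (rho w (e l)).

End Representation.

Section Modules.
Variables (R : realType) (theta : R) (n : nat).
Local Notation A := (S7 theta).
Local Notation B := (S4 theta).
Local Notation z := (zgen theta).

Definition ket4 (a b c d : A) : 'I_4 -> A := tnth [tuple a; b; c; d].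

Definition psi1 : 'I_4 -> A := ket4 (z 0) (- S7star (z 1)) (z 2) (- S7star (z 3)).
Definition psi2 : 'I_4 -> A := ket4 (z 1) (S7star (z 0)) (z 3) (S7star (z 2)).

(* |phi_k>, with k shifted by one. *)
Definition ket (k : nat) : tens 4 n A :=
  (acoef R n k)^-1 *: otimesS n k psi1 psi2.

Definition braket (xi eta : tens 4 n A) : A := \sum_i S7star (xi i) * eta i.

Definition pn (i j : {ffun 'I_n -> 'I_4}) : A :=
  \sum_(k < n.+1) ket k i * S7star (ket k j).

Definition incl (f : tens 4 n B) : tens 4 n A := [ffun i => S4val (f i)].

Definition pn_app (f : tens 4 n B) : tens 4 n A :=
  [ffun i : {ffun 'I_n -> 'I_4} => \sum_j pn i j * incl f j].

(* p_(n)(A(S^4)^(4^n)) is formed inside A(S^7)^(4^n), of which A(S^4)^(4^n) is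
   a subset through incl. *)
Definition Gamma_pred : {pred tens 4 n A} :=
  fun sigma => `[< exists f, sigma = pn_app f >].

Lemma pn_appB f g : pn_app (f - g) = pn_app f - pn_app g.
Proof.
apply/ffunP=> i; rewrite !ffunE -sumrB; apply: eq_bigr => j _.
by rewrite !ffunE -mulrBr.
Qed.

Lemma Gamma_zmod : zmod_closed Gamma_pred.
Proof.
split=> [|_ _ /asboolP[f ->] /asboolP[g ->]]; apply/asboolP.
  by exists 0; rewrite -[X in pn_app X](subrr 0) pn_appB subrr.
by exists (f - g); rewrite pn_appB.
Qed.

Record Gamma : predArgType :=
  MkGamma { Gamma_val :> tens 4 n A; Gamma_valP : Gamma_val \in Gamma_pred }.

HB.instance Definition _ := [isSub for Gamma_val].
HB.instance Definition _ := [Choice of Gamma by <:].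
HB.instance Definition _ :=
  GRing.SubChoice_isSubZmodule.Build _ Gamma_pred Gamma Gamma_zmod.

Lemma Gamma_act_subproof (a : B) (sigma : Gamma) :
  [ffun i => sigma i * S4val a] \in Gamma_pred.
Proof.
case: sigma => _ /= /asboolP[f ->]; apply/asboolP; exists [ffun i => f i * a].
apply/ffunP=> i; rewrite !ffunE mulr_suml; apply: eq_bigr => j _.
by rewrite !ffunE mulrA.
Qed.

Definition Gamma_act (a : B) (sigma : Gamma) : Gamma :=
  MkGamma (Gamma_act_subproof a sigma).

Let Gamma_actA (a b : B^c) sigma :
  Gamma_act a (Gamma_act b sigma) = Gamma_act (a * b) sigma.
Proof. by apply/val_inj/ffunP=> i; rewrite !ffunE -mulrA. Qed.
Let Gamma_act1 : left_id (1 : B^c) Gamma_act.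
Proof. by move=> sigma; apply/val_inj/ffunP=> i; rewrite !ffunE mulr1. Qed.
Let Gamma_actDr : right_distributive Gamma_act +%R.
Proof. by move=> a s t; apply/val_inj/ffunP=> i; rewrite !ffunE mulrDl. Qed.
Let Gamma_actDl sigma (a b : B^c) :
  Gamma_act (a + b) sigma = Gamma_act a sigma + Gamma_act b sigma.
Proof. by apply/val_inj/ffunP=> i; rewrite !ffunE -mulrDr. Qed.

(* Right A(S^4)-modules are left modules over the converse ring. *)
HB.instance Definition _ := GRing.Zmodule_isLmodule.Build B^c Gamma
  Gamma_actA Gamma_act1 Gamma_actDr Gamma_actDl.

Lemma psection_subproof f : pn_app f \in Gamma_pred.
Proof. by apply/asboolP; exists f. Qed.

Definition psection (f : tens 4 n B) : Gamma := MkGamma (psection_subproof f).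

Definition coequivariant (phi : V R n -> A) : Prop :=
  forall (w : SU2 R) (k : 'I_n.+1),
    \sum_(l < n.+1) rho_mx n (invmx w) k l *: phi (e R n l)
      = alpha w (phi (e R n k)).

Definition Hom_pred : {pred V R n -> A} :=
  fun phi => `[< linear phi /\ coequivariant phi >].

Lemma Hom_zmod : zmod_closed Hom_pred.
Proof.
split=> [|f g /asboolP[lf cf] /asboolP[lg cg]]; apply/asboolP; split.
- by move=> k u v; rewrite !addr0 scaler0.
- by move=> w k; rewrite raddf0 big1 // => l _; rewrite scaler0.
- have E h : (f - g) h = f h - g h by [].
  by move=> k u v; rewrite !E lf lg scalerBr opprD addrACA.
- move=> w k; rewrite [X in alpha _ X](_ : _ = f (e R n k) - g (e R n k)) //.
  rewrite raddfB /= -cf -cg -sumrB; apply: eq_bigr => l _.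
  by rewrite -scalerBr.
Qed.

Record Hom_rho : predArgType :=
  MkHom { Hom_val :> V R n -> A; Hom_valP : Hom_val \in Hom_pred }.

HB.instance Definition _ := [isSub for Hom_val].
HB.instance Definition _ := [Choice of Hom_rho by <:].
HB.instance Definition _ :=
  GRing.SubChoice_isSubZmodule.Build _ Hom_pred Hom_rho Hom_zmod.

Lemma Hom_act_subproof (a : B) (phi : Hom_rho) :
  (fun v => phi v * S4val a) \in Hom_pred.
Proof.
case: phi => f /= /asboolP[lf cf]; apply/asboolP; split=> [k u v|w k].
  by rewrite lf mulrDl scalerAl.
have /asboolP fa := S4valP a.
rewrite rmorphM /= fa -cf mulr_suml; apply: eq_bigr => l _.
by rewrite scalerAl.
Qed.

Definition Hom_act (a : B) (phi : Hom_rho) : Hom_rho :=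
  MkHom (Hom_act_subproof a phi).

Let Hom_actA (a b : B^c) phi : Hom_act a (Hom_act b phi) = Hom_act (a * b) phi.
Proof. by apply/val_inj/funext=> v; rewrite /= -mulrA. Qed.
Let Hom_act1 : left_id (1 : B^c) Hom_act.
Proof. by move=> phi; apply/val_inj/funext=> v; rewrite /= mulr1. Qed.
Let Hom_actDr : right_distributive Hom_act +%R.
Proof. by move=> a f g; apply/val_inj/funext=> v; rewrite /= -mulrDl. Qed.
Let Hom_actDl phi (a b : B^c) : Hom_act (a + b) phi = Hom_act a phi + Hom_act b phi.
Proof. by apply/val_inj/funext=> v; rewrite /= -mulrDr. Qed.

HB.instance Definition _ := GRing.Zmodule_isLmodule.Build B^c Hom_rho
  Hom_actA Hom_act1 Hom_actDr Hom_actDl.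

End Modules.

(* Main.v *)
From HB Require Import structures.
From mathcomp Require Import all_boot all_order all_algebra all_fingroup reals.
From mathcomp Require Import complex spectral boolp.
Require Import Defs.

(** Side by side, the columns [psi1] and [psi2] form two quaternions, the matrices
    with rows (z1, z2), (- conj z2, conj z1) and (z3, z4), (- conj z4, conj z3).
    As [w] in SU(2) is a quaternion too, [alpha_w] acts on the pair of columns by
    right multiplication by [w] ([alpha_psi]).  Tensoring
    n times, the map [contract] sends a tensor t on C^2 to the combination of
    products of psi's with coefficients t; it intertwines [tpow w] with
    [alpha_w], and it sends the basis vector e_k to the ket phi_k.  So the kets
    transform by the matrix of rho_n ([alpha_ket]) and, because that matrix is
    unitary ([rho_mx_inv]), the bras transform by the matrix of the inverse
    ([alpha_star_ket]).  Hence e_k |-> <phi_k|f> is coequivariant for every f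
    with invariant entries.

    In the other direction, a coequivariant phi gives the vector
    sum_k |phi_k> phi(e_k), whose entries are invariant because the two factors
    transform by mutually inverse matrices ([coeq_inv_subproof]); it is therefore
    an admissible f.  The two constructions are inverse to each other because the
    kets are orthonormal ([braket_ket]), which makes both compositions the
    identity on coefficients.

    Orthonormality survives noncommutativity for the following reason.  The star
    reverses products, so the pairing of two elementary tensors is a nested
    expression in which the innermost pairing is that of the first factors.
    When it is a scalar it can be pulled out, which exposes the pairing of the
    next factors, and so on ([herm_tensor]).  The same computation in the
    *-algebra C shows that the e_k are orthonormal; together with the fact that
    they span the symmetric tensors ([e_span]), it turns coordinates into scalar
    products and gives the unitarity of rho_n(w). *)

Import Order.TTheory GRing.Theory Num.Theory.
Local Open Scope ring_scope.

Set Implicit Arguments.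
Unset Strict Implicit.
Unset Printing Implicit Defensive.

(** * Hermitian pairing of tensors over a *-algebra *)

Lemma sum_ffun_recr (M : nmodType) (d n : nat)
    (F : {ffun 'I_n.+1 -> 'I_d} -> M) :
  \sum_i F i = \sum_(i : {ffun 'I_n -> 'I_d}) \sum_a
     F [ffun m => if unlift ord_max m is Some m' then i m' else a].
Proof.
rewrite pair_big /=.
pose split_last (i : {ffun 'I_n.+1 -> 'I_d}) :=
  ([ffun m : 'I_n => i (lift ord_max m)], i ord_max).
pose join_last (p : {ffun 'I_n -> 'I_d} * 'I_d) : {ffun 'I_n.+1 -> 'I_d} :=
  [ffun m => if unlift ord_max m is Some m' then p.1 m' else p.2].
rewrite (reindex_omap join_last (fun i => Some (split_last i))) /=; last first.
  move=> i _; congr Some; apply/ffunP=> m; rewrite ffunE.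
  by case: unliftP => [m' ->|->] //=; rewrite ffunE.
apply: eq_bigl => -[i a] /=; apply/eqP; rewrite /split_last; congr (Some (_, _)).
  by apply/ffunP=> m; rewrite !ffunE liftK.
by rewrite ffunE unlift_none.
Qed.

Lemma neq_set_witness (T : finType) (s t : {set T}) :
  s != t -> exists x, (x \in s) != (x \in t).
Proof.
move/eqP=> st; apply/existsP; apply: contra_notT st => /existsPn H.
by apply/setP => x; apply/eqP; move/negPn: (H x).
Qed.

Section StarAlgebra.
Variables (R : realType) (B : algType R[i]) (st : B -> B) (stP : is_star st).

Lemma star0 : st 0 = 0.
Proof. by rewrite -(scale0r 0) (is_starZ stP) conjC0 !scale0r. Qed.

Lemma starN (x : B) : st (- x) = - st x.
Proof. by rewrite -scaleN1r (is_starZ stP) rmorphN1 scaleN1r. Qed.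

Lemma star_sum (I : Type) (r : seq I) (P : pred I) (F : I -> B) :
  st (\sum_(i <- r | P i) F i) = \sum_(i <- r | P i) st (F i).
Proof. by apply: (big_morph st (is_starD stP)); exact: star0. Qed.

Lemma star1 : st 1 = 1.
Proof.
rewrite -[RHS](is_starK stP) -[in RHS](mul1r (st 1)).
by rewrite (is_starM stP) (is_starK stP) mul1r.
Qed.

Definition herm (I : finType) (x y : I -> B) : B := \sum_i st (x i) * y i.

Lemma herm_sym (I : finType) (x y : I -> B) : st (herm x y) = herm y x.
Proof.
by rewrite star_sum; apply: eq_bigr => i _; rewrite (is_starM stP) (is_starK stP).
Qed.

(** The star reverses the order of the factors, so the first factors meet in the
    middle of each term; their pairing is a scalar and leaves the expression,
    after which the second factors meet.  The induction peels the factors off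
    from the outside, that is, from the last one. *)
Lemma herm_tensor (d n : nat) (x y : 'I_n -> 'I_d -> B) (c : 'I_n -> R[i]) :
    (forall m, herm (x m) (y m) = (c m)%:A) ->
  herm (fun i : {ffun 'I_n -> 'I_d} => \prod_m x m (i m))
       (fun i => \prod_m y m (i m)) = (\prod_m c m)%:A.
Proof.
elim: n x y c => [|n IHn] x y c xyc; rewrite /herm.
  rewrite (big_pred1 (finfun (ffun0 (card_ord 0)))) => [|i]; last first.
    by apply/esym/eqP/ffunP=> -[].
  by rewrite !big_ord0 star1 mulr1 scale1r.
rewrite sum_ffun_recr exchange_big /=.
have widenE m : widen_ord (leqnSn n) m = lift ord_max m.
  by apply/val_inj; rewrite /= /bump leqNgt ltn_ord.
rewrite big_ord_recr /=.
transitivity (\sum_a st (x ord_max a) *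
    herm (fun i : {ffun 'I_n -> 'I_d} => \prod_m x (lift ord_max m) (i m))
       (fun i => \prod_m y (lift ord_max m) (i m)) * y ord_max a).
  apply: eq_bigr => a _; rewrite mulr_sumr mulr_suml; apply: eq_bigr => i _.
  rewrite !big_ord_recr /= !ffunE unlift_none (is_starM stP) !mulrA.
  by congr (_ * st _ * _ * _); apply: eq_bigr => m _;
    rewrite widenE ffunE liftK.
rewrite (IHn (fun m => x (lift ord_max m)) (fun m => y (lift ord_max m))
  (fun m => c (lift ord_max m))) => [|m]; last exact: xyc.
rewrite (eq_bigr (fun a => (\prod_m c (lift ord_max m)) *:
  (st (x ord_max a) * y ord_max a))) => [|a _]; last first.
  by rewrite -scalerAr mulr1 -scalerAl.
rewrite -scaler_sumr; have := xyc ord_max; rewrite /herm => ->; rewrite scalerA.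
by congr ((_ * _) *: _); apply: eq_bigr => m _; rewrite widenE.
Qed.

(** Orderings indexed by s and t pair to a product over the positions m of
    1 or 0 according to whether m belongs to both or neither of s and t, hence
    to 0 unless s = t: what remains counts the subsets of size k. *)
Lemma herm_otimesS (d n k l : nat) (u v : 'I_d -> B) :
    herm u u = 1 -> herm v v = 1 -> herm u v = 0 ->
  herm (otimesS n k u v) (otimesS n l u v) =
    (if k == l then 'C(n, k) else 0)%:R.
Proof.
move=> uu vv uv.
have vu : herm v u = 0 by rewrite -herm_sym uv star0.
pose pick (s : {set 'I_n}) m a := if m \in s then v a else u a.
transitivity (\sum_(s : {set 'I_n} | #|s| == k) \sum_(t : {set 'I_n} | #|t| == l)
    herm (fun i : {ffun 'I_n -> 'I_d} => \prod_m pick s m (i m))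
         (fun i => \prod_m pick t m (i m))).
  rewrite /herm; under eq_bigr do rewrite !ffunE star_sum big_distrlr /=.
  by rewrite exchange_big; apply: eq_bigr => s _; rewrite exchange_big.
have pickE s t : herm (fun i : {ffun 'I_n -> 'I_d} => \prod_m pick s m (i m))
         (fun i => \prod_m pick t m (i m)) = (s == t)%:R.
  rewrite (@herm_tensor _ _ _ _ (fun m => ((m \in s) == (m \in t))%:R)) => [|m].
    have [<-|/neq_set_witness[m sm]] := altP eqP.
      by rewrite big1 ?scale1r // => m _; rewrite eqxx.
    by rewrite (bigD1 m) //= (negPf sm) mul0r scale0r.
  by rewrite /pick; case: (m \in s); case: (m \in t);
    rewrite ?uu ?vv ?uv ?vu ?scale1r ?scale0r.
under eq_bigr do under eq_bigr do rewrite pickE.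
have [<-|kl] := eqVneq k l.
  transitivity (\sum_(s : {set 'I_n} | #|s| == k) 1 : B).
    apply: eq_bigr => s sk; rewrite (bigD1 s) //= eqxx.
    by rewrite big1 ?addr0 // => t /andP[_]; rewrite eq_sym => /negPf->.
  by rewrite sumr_const -[n in 'C(n, _)]card_ord -card_draws cardsE.
rewrite big1 // => s /eqP sk; rewrite big1 // => t /eqP tl.
by case: eqP => // st'; rewrite -sk -tl st' eqxx in kl.
Qed.

Lemma conj_acoef n k : (acoef R n k)^-1^* = (acoef R n k)^-1.
Proof. by rewrite geC0_conj // invr_ge0 sqrtC_ge0 ler0n. Qed.

Lemma herm_normalized (d n k l : nat) (u v : 'I_d -> B) :
    herm u u = 1 -> herm v v = 1 -> herm u v = 0 -> (k <= n)%N ->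
  herm (fun i => (acoef R n k)^-1 *: otimesS n k u v i)
       (fun i => (acoef R n l)^-1 *: otimesS n l u v i) = (k == l)%:R.
Proof.
move=> uu vv uv kn.
have := herm_otimesS n k l uu vv uv; rewrite /herm => H.
transitivity (((acoef R n k)^-1 * (acoef R n l)^-1) *:
  (\sum_i st (otimesS n k u v i) * otimesS n l u v i)).
  rewrite scaler_sumr; apply: eq_bigr => i _.
  by rewrite (is_starZ stP) conj_acoef -scalerAl -scalerAr scalerA.
rewrite H; have [<-|] := eqVneq k l; last by rewrite scaler0.
rewrite -invfM -expr2 sqrtCK -[X in _ *: X]scaler_nat scalerA mulVf ?scale1r //.
by rewrite pnatr_eq0 -lt0n bin_gt0.
Qed.

End StarAlgebra.

(** * The symmetric power of the plane and its unitary structure *)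

Section SymmetricTensors.
Variables (R : realType) (n : nat).
Local Notation C := (R[i]^o).
Local Notation T := (tens 2 n C).
Local Notation basis := [tuple e R n i | i < n.+1].

Lemma conj_is_star : is_star (Num.conj : C -> C).
Proof.
split=> [x y|x y|k x|x]; first exact: rmorphD.
- by rewrite rmorphM mulrC.
- exact: rmorphM.
- exact: conjCK.
Qed.

Definition indic (s : {set 'I_n}) : {ffun 'I_n -> 'I_2} :=
  [ffun m => if m \in s then 1 else 0].
Definition support1 (i : {ffun 'I_n -> 'I_2}) := [set m | i m == 1].

Lemma ord2_neq0 (a : 'I_2) : (a == 0) = (a != 1).
Proof. by case: a => [[|[|]]]. Qed.

Lemma eq_indic i s : (i == indic s) = (s == support1 i).
Proof.
apply/eqP/eqP => [->|->]; first by apply/setP=> m; rewrite !inE ffunE; case: ifP.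
apply/ffunP=> m; rewrite ffunE inE; have [->|] // := eqVneq (i m) 1.
by rewrite -ord2_neq0 => /eqP.
Qed.

Lemma prod_eps (s : {set 'I_n}) (i : {ffun 'I_n -> 'I_2}) :
  \prod_m (if m \in s then (i m == 1)%:R else (i m == 0)%:R) =
    (i == indic s)%:R :> C.
Proof.
rewrite eq_indic; have [->|/neq_set_witness[m sm]] := eqVneq s (support1 i).
  by apply: big1 => m _; rewrite inE ord2_neq0; case: eqP.
rewrite (bigD1 m) //= ord2_neq0; move: sm; rewrite inE.
by case: (m \in s); case: (i m == 1); rewrite //= mul0r.
Qed.

Lemma otimesS_eps k (i : {ffun 'I_n -> 'I_2}) :
  otimesS n k (fun a : 'I_2 => (a == 0)%:R : C) (fun a => (a == 1)%:R) i
    = (#|support1 i| == k)%:R.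
Proof.
rewrite ffunE; under eq_bigr do rewrite prod_eps eq_indic.
have [ik|ik] := eqVneq #|support1 i| k.
  rewrite (bigD1 (support1 i)) ?ik //= eqxx big1 ?addr0 // => s /andP[_ si].
  by rewrite (negPf si).
by rewrite big1 // => s sk; case: eqP => // si; rewrite -si sk in ik.
Qed.

Lemma eT_E k i : eT R n k i = (acoef R n k)^-1 * (#|support1 i| == k)%:R.
Proof. by rewrite ffunE otimesS_eps. Qed.

Definition dot (x y : {ffun 'I_n -> 'I_2} -> R[i]) : R[i] := \sum_i (x i)^* * y i.

Lemma dot_eT k l : (k <= n)%N -> dot (eT R n k) (eT R n l) = (k == l)%:R.
Proof.
pose eps (b a : 'I_2) : C := (a == b)%:R.
have epsE (b c : 'I_2) : herm (Num.conj : C -> C) (eps b) (eps c) = (b == c)%:R.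
  rewrite /herm (bigD1 b) //= /eps eqxx conjC1 mul1r big1 ?addr0 // => a /negPf->.
  by rewrite conjC0 mul0r.
move=> kn; rewrite -[RHS](@herm_normalized R C _ conj_is_star 2 n k l
    (eps 0) (eps 1)) ?epsE //.
apply: eq_bigr => i _.
have eTE m :
    eT R n m i = (acoef R n m)^-1 *: otimesS n m (eps 0) (eps 1) i :> C.
  by rewrite [LHS]ffunE.
by congr (_^* * _); exact: eTE.
Qed.

(** Two index functions with values in a set of two elements and with equally many
    values 1 differ by a permutation of the positions, under which a symmetric
    tensor is invariant. *)
Lemma Sym_support1 (t : T) i j :
  t \in Sym R n -> #|support1 i| = #|support1 j| -> t i = t j.
Proof.
move=> /mem_Sym tS ij.
have countE a (k : {ffun 'I_n -> 'I_2}) :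
    count_mem a [tuple k m | m < n] =
      if a == 1 then #|support1 k| else (n - #|support1 k|)%N.
  rewrite /= count_map.
  have -> : #|support1 k| = count (fun m => k m == 1) (enum 'I_n).
    rewrite cardE enumT -size_filter; congr size.
    by apply: eq_filter => m; rewrite /= inE.
  case: eqP => [->|/eqP]; first exact: eq_count.
  rewrite -ord2_neq0 => /eqP->; rewrite -[X in (X - _)%N](size_enum_ord n).
  rewrite -(count_predC (fun m => k m == 1)) addKn.
  by apply: eq_count => m /=; rewrite ord2_neq0.
have /tuple_permP[p] : perm_eq [tuple i m | m < n] [tuple j m | m < n].
  by apply/allP=> a _; rewrite /= !countE ij.
move/val_inj => ijp; rewrite -[in RHS](tS p) ffunE.
suff -> : i = [ffun m => j (p m)] by [].
apply/ffunP=> m.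
by move: (congr1 (fun u => tnth u m) ijp); rewrite ffunE !tnth_mktuple.
Qed.

Lemma vsval_sum_e (c : 'I_n.+1 -> R[i]) i :
  (vsval (\sum_k c k *: e R n k) : T) i = \sum_k c k * eT R n k i.
Proof.
rewrite raddf_sum sum_ffunE; apply: eq_bigr => k _.
rewrite [X in fun_of_fin X i](_ : _ = c k *: eT R n k); last first.
  by rewrite -[RHS]/(c k *: vsval (e R n k)) -linearZ.
by rewrite [LHS]ffunE.
Qed.

(** The entry of a symmetric tensor at i depends only on the number of 1's in i,
    and e_k is, up to a scalar, the indicator of that number being k. *)
Lemma e_span (v : V R n) : v \in <<basis>>%VS.
Proof.
(* One index function with k values 1 for each k. *)
pose rep k : {ffun 'I_n -> 'I_2} := indic [set m : 'I_n | (m < k)%N].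
have repE k : (k <= n)%N -> #|support1 (rep k)| = k.
  move=> kn; have /eqP <- : [set m : 'I_n | (m < k)%N] == support1 (rep k).
    by rewrite -eq_indic.
  have widen_inj : injective (widen_ord kn) by move=> a b [ab]; exact: val_inj.
  rewrite -[RHS]card_ord -(card_imset _ widen_inj); apply: eq_card => m.
  rewrite inE; apply/idP/imsetP => [mk|[m' _ ->]]; last by rewrite /= ltn_ord.
  by exists (Ordinal mk) => //; apply/val_inj.
have -> : v = \sum_(k < n.+1) (acoef R n k * vsval v (rep k)) *: e R n k.
  apply/val_inj/ffunP => i; rewrite vsval_sum_e.
  have ci : (#|support1 i| < n.+1)%N.
    by rewrite ltnS -[n in (_ <= n)%N]card_ord max_card.
  rewrite (bigD1 (Ordinal ci)) //= big1 ?addr0 => [|k ki].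
    rewrite eT_E eqxx mulr1 mulrAC mulfV ?mul1r; last first.
      by rewrite sqrtC_eq0 pnatr_eq0 -lt0n bin_gt0.
    by apply: Sym_support1; [exact: subvsP | rewrite repE].
  rewrite eT_E; case: eqP => [ik|]; last by rewrite !mulr0.
  by case/eqP: ki; apply/val_inj.
apply: rpred_sum => k _; apply: rpredZ; apply: memv_span.
by apply/tnthP; exists k; rewrite tnth_mktuple.
Qed.

Lemma e_decomp (v : V R n) : v = \sum_(k < n.+1) coord basis k v *: e R n k.
Proof.
rewrite {1}(coord_span (e_span v)); apply: eq_bigr => k _.
by rewrite -tnth_nth tnth_mktuple.
Qed.

Lemma coord_eE (k : 'I_n.+1) (v : V R n) :
  coord basis k v = dot (eT R n k) (vsval v : T).
Proof.
rewrite {2}(e_decomp v) /dot.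
under eq_bigr do rewrite vsval_sum_e mulr_sumr.
rewrite exchange_big.
transitivity (\sum_(l < n.+1) coord basis l v * (k == l)%:R).
  rewrite (bigD1 k) //= eqxx mulr1 big1 ?addr0 // => l.
  by rewrite eq_sym => /negPf->; rewrite mulr0.
apply: eq_bigr => l _; rewrite -(dot_eT _ (ltn_ord k : (k <= n)%N)) mulr_sumr.
by apply: eq_bigr => i _; rewrite mulrCA.
Qed.

Lemma coord_e (k l : 'I_n.+1) : coord basis k (e R n l) = (k == l)%:R.
Proof. by rewrite coord_eE; exact: dot_eT (ltn_ord k). Qed.

Lemma dot_tpow (w : 'M[R[i]]_2) (x y : T) :
  dot x (tpow w y) = dot (tpow (map_mx Num.conj w^T) x) y.
Proof.
rewrite /dot; under eq_bigr do rewrite ffunE mulr_sumr.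
rewrite exchange_big; apply: eq_bigr => j _; rewrite ffunE rmorph_sum mulr_suml.
apply: eq_bigr => i _; rewrite rmorphM rmorph_prod mulrA; congr (_ * _).
rewrite mulrC; congr (_ * _).
by apply: eq_bigr => m _; rewrite !mxE; exact/esym/conjCK.
Qed.

Lemma dot_sym (x y : T) : (dot x y)^* = dot y x.
Proof.
rewrite rmorph_sum; apply: eq_bigr => i _.
by rewrite rmorphM /= conjCK mulrC.
Qed.

Lemma rho_mxE w (k l : 'I_n.+1) :
  rho_mx n w k l = dot (eT R n k) (tpow w (eT R n l)).
Proof. by rewrite mxE coord_eE. Qed.

Lemma tpow_eT w (l : 'I_n.+1) i :
  tpow w (eT R n l) i = \sum_(k < n.+1) rho_mx n w k l * eT R n k i.
Proof.
have -> : tpow w (eT R n l) = vsval (rho w (e R n l)) by [].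
rewrite (e_decomp (rho w (e R n l))) vsval_sum_e.
by apply: eq_bigr => k _; rewrite mxE.
Qed.

Lemma tpowM (w w' : 'M[R[i]]_2) (t : T) : tpow (w *m w') t = tpow w (tpow w' t).
Proof.
apply/ffunP => i; rewrite [LHS]ffunE [RHS]ffunE.
transitivity (\sum_(k : {ffun 'I_n -> 'I_2}) \sum_(j : {ffun 'I_n -> 'I_2})
    (\prod_m (w (i m) (j m) * w' (j m) (k m))) * t k).
  apply: eq_bigr => k _; rewrite -mulr_suml; congr (_ * _).
  rewrite -(bigA_distr_bigA (fun m a => w (i m) a * w' a (k m))).
  by apply: eq_bigr => m _; rewrite mxE.
rewrite exchange_big; apply: eq_bigr => j _; rewrite ffunE mulr_sumr.
by apply: eq_bigr => k _; rewrite big_split mulrA.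
Qed.

Lemma rho_mxM (w w' : 'M[R[i]]_2) :
  rho_mx n (w *m w') = rho_mx n w *m rho_mx n w'.
Proof.
apply/matrixP => j l; rewrite (rho_mxE (w *m w') j l) tpowM mxE /dot.
transitivity (\sum_i \sum_(k < n.+1)
    (eT R n j i)^* * (tpow w (eT R n k) i * rho_mx n w' k l)).
  apply: eq_bigr => i _; rewrite -mulr_sumr; congr (_ * _).
  rewrite ffunE; under [RHS]eq_bigr do rewrite ffunE mulr_suml.
  rewrite exchange_big; apply: eq_bigr => j' _; rewrite tpow_eT mulr_sumr.
  by apply: eq_bigr => k _; rewrite -mulrA; congr (_ * _); rewrite mulrC.
rewrite exchange_big; apply: eq_bigr => k _.
rewrite (rho_mxE w j k) /dot mulr_suml.
by apply: eq_bigr => i _; rewrite mulrA.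
Qed.

Lemma rho_mx1 : rho_mx n (1%:M : 'M[R[i]]_2) = 1%:M.
Proof.
apply/matrixP => k l; rewrite (rho_mxE 1%:M k l) mxE.
suff -> : tpow 1%:M (eT R n l) = eT R n l by exact: dot_eT (ltn_ord k).
apply/ffunP => i; rewrite [LHS]ffunE (bigD1 i) //= big1 => [|m _]; last first.
  by rewrite mxE eqxx.
rewrite mul1r big1 ?addr0 // => j ji.
have [m im] : exists m, i m != j m.
  by apply/existsP; apply: contraNT ji => /existsPn H; apply/eqP/ffunP => m;
    apply/esym/eqP; move/negPn: (H m).
by rewrite (bigD1 m) //= mxE (negPf im) !mul0r.
Qed.

(** rho_n(w) is unitary: in an orthonormal basis, the adjoint of a tensor power is
    the tensor power of the adjoint. *)
Lemma rho_mx_inv (w : SU2 R) (k l : 'I_n.+1) :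
  rho_mx n (invmx w) k l = (rho_mx n w l k)^*.
Proof.
rewrite (rho_mxE (invmx w) k l) (rho_mxE w l k) dot_sym.
have -> := invmx_unitary (su2_unitary w).
by rewrite dot_tpow trmxCK.
Qed.

Lemma rho_mx_invR (w : SU2 R) : rho_mx n w *m rho_mx n (invmx w) = 1%:M.
Proof. by rewrite -rho_mxM mulmxV ?rho_mx1 // unitmxE su2_det unitr1. Qed.

End SymmetricTensors.

(** * The kets and their transformation under SU(2) *)

Section Kets.
Variables (R : realType) (theta : R).
Local Notation A := (S7 theta).
Local Notation z := (zgen theta).
Local Notation st := (@S7star R theta).

(** For a unitary matrix of determinant 1 both the adjoint and the adjugate are
    the inverse. *)
Lemma conj_SU2 (w : SU2 R) (a b : 'I_2) : (w a b)^* = cofactor w a b.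
Proof.
have adjE : map_mx Num.conj w^T = \adj w.
  rewrite -[LHS]mul1mx -[X in X%:M *m _](su2_det w) -mul_adj_mx -mulmxA.
  by rewrite (unitarymxP (su2_unitary w)) mulmx1.
by have := congr1 (fun M : 'M_2 => M b a) adjE; rewrite !mxE.
Qed.

Lemma SU2_entries (w : SU2 R) : (w 1 1 = (w 0 0)^*) * (w 1 0 = - (w 0 1)^*).
Proof.
rewrite !conj_SU2 /cofactor !det_mx11 !mxE /= expr0 expr1 mul1r mulN1r opprK.
by split; congr (su2_mx w _ _); apply/val_inj.
Qed.

Let alpha_zl (w : SU2 R) (b : 'I_2) :
  alpha w (z (lshift 2 b)) = \sum_(c < 2) w c b *: z (lshift 2 c).
Proof.
rewrite alpha_gen (@big_split_ord _ _ _ 2 2) /= [X in _ + X]big1 => [|c _].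
  rewrite addr0; apply: eq_bigr => c _.
  by rewrite /diag2 (@block_mxEul _ 2 2 2 2).
by rewrite /diag2 (@block_mxEdl _ 2 2 2 2) mxE scale0r.
Qed.

Let alpha_zr (w : SU2 R) (b : 'I_2) :
  alpha w (z (rshift 2 b)) = \sum_(c < 2) w c b *: z (rshift 2 c).
Proof.
rewrite alpha_gen (@big_split_ord _ _ _ 2 2) /= [X in X + _]big1 => [|c _].
  rewrite add0r; apply: eq_bigr => c _.
  by rewrite /diag2 (@block_mxEdr _ 2 2 2 2).
by rewrite /diag2 (@block_mxEur _ 2 2 2 2) mxE scale0r.
Qed.

Definition psi (b : 'I_2) : 'I_4 -> A :=
  if b == 0 then psi1 theta else psi2 theta.

(** The entries - conj z2, conj z1 (and likewise - conj z4, conj z3) transform by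
    the conjugates of the entries of w, which the identities w11 = conj w00 and
    w10 = - conj w01 convert back into the row rule obeyed by z1, z2. *)
Lemma alpha_psi (w : SU2 R) (b : 'I_2) (a : 'I_4) :
  alpha w (psi b a) = \sum_c w c b *: psi c a.
Proof.
have E0 : (0 : 'I_4) = lshift 2 (0 : 'I_2) by apply/val_inj.
have E1 : (1 : 'I_4) = lshift 2 (1 : 'I_2) by apply/val_inj.
have E2 : (2 : 'I_4) = rshift 2 (0 : 'I_2) by apply/val_inj.
have E3 : (3 : 'I_4) = rshift 2 (1 : 'I_2) by apply/val_inj.
have stD := is_starD (@S7starP R theta); have stZ := is_starZ (@S7starP R theta).
have sum2 (F : 'I_2 -> A) : \sum_c F c = F 0 + F 1.
  by rewrite !big_ord_recl big_ord0 addr0; congr (_ + F _); apply/val_inj.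
(* The numerals 2 and 3 are sums of 1's, so they are replaced before 1 is. *)
rewrite /psi /psi1 /psi2 /ket4 E3 E2 E1 E0 sum2 /=.
have ord2E : (b == 0) || (b == 1) by case: b => [[|[|]]].
case: a => [[|[|[|[|//]]]] lt_a]; rewrite !(tnth_nth 0) /=;
  case/orP: ord2E => /eqP-> /=;
  rewrite ?raddfN /= ?alpha_star ?alpha_zl ?alpha_zr ?sum2 ?stD ?stZ;
  rewrite ?(SU2_entries w) ?raddfN /= ?conjCK ?scalerN ?scaleNr ?opprD ?opprK //;
  by rewrite addrC.
Qed.

(** Only generators within the same pair {1,2} or {3,4} are multiplied together
    here, and for these every lambda is 1; so the diagonal pairings reduce to the
    sphere relation, and the off-diagonal ones cancel. *)
Lemma herm_psi (b c : 'I_2) : herm st (psi b) (psi c) = (b == c)%:R.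
Proof.
have zr := zgen_rel theta.
have stN := starN (@S7starP R theta); have stK := is_starK (@S7starP R theta).
have comm (i j : 'I_4) : (i < 2)%N = (j < 2)%N -> st (z i) * z j = z j * st (z i).
  by move=> ij; rewrite (S7rel_czz zr) /lam ij eqxx scale1r.
have sum4 (F : 'I_4 -> A) : \sum_c F c = F 0 + F 1 + F 2 + F 3.
  rewrite !big_ord_recl big_ord0 addr0 !addrA.
  by congr (_ + F _ + F _ + F _); apply/val_inj.
have sphere := S7rel_sphere zr; rewrite sum4 in sphere.
rewrite /herm sum4 /psi /psi1 /psi2 /ket4.
have ord2E (a : 'I_2) : (a == 0) || (a == 1) by case: a => [[|[|]]].
case/orP: (ord2E b) => /eqP->; case/orP: (ord2E c) => /eqP-> /=;
  rewrite !(tnth_nth 0) /= ?stN ?stK ?mulrNN ?mulNr ?mulrN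
    ?(comm 0 0) ?(comm 0 1) ?(comm 1 0) ?(comm 1 1) ?(comm 2 2) ?(comm 2 3)
    ?(comm 3 2) ?(comm 3 3) //.
- by rewrite subrr add0r subrr.
- by rewrite subrr add0r subrr.
- by rewrite [X in X + _ + _](addrC (z 1 * _)) -addrA [X in _ + X]addrC addrA.
Qed.

Variable n : nat.
Local Notation T := (tens 2 n R[i]^o).
Local Notation ket := (ket theta n).

(** The linear extension to tensors of
    epsilon_j1 (x) ... (x) epsilon_jn |-> psi_j1 (x) ... (x) psi_jn. *)
Definition contract (t : {ffun 'I_n -> 'I_2} -> R[i])
    (i : {ffun 'I_n -> 'I_4}) : A :=
  \sum_j t j *: \prod_m psi (j m) (i m).

Lemma ket_contract k i : ket k i = contract (eT R n k) i.
Proof.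
rewrite /contract ffunE ffunE scaler_sumr.
(* The ordering s contributes to e_k the single basis tensor indexed by indic s. *)
transitivity (\sum_j \sum_(s : {set 'I_n} | #|s| == k)
   ((acoef R n k)^-1 * (j == indic s)%:R) *: \prod_m psi (j m) (i m)); last first.
  apply: eq_bigr => j _; rewrite -scaler_suml -mulr_sumr eT_E.
  congr ((_ * _) *: _); rewrite -otimesS_eps ffunE.
  by apply: eq_bigr => s _; exact/esym/prod_eps.
rewrite exchange_big; apply: eq_bigr => s _.
rewrite (bigD1 (indic s)) //= eqxx mulr1.
rewrite [X in _ + X]big1 ?addr0 => [|j /negPf->]; last first.
  by rewrite mulr0 scale0r.
congr (_ *: _); apply: eq_bigr => m _; rewrite ffunE /psi.
by case: ifP.
Qed.

(** Expanding the product of the n sums given by [alpha_psi] produces the matrix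
    entries of the n-th tensor power of w. *)
Lemma alpha_contract (w : SU2 R) (t : T) i :
  alpha w (contract t i) = contract (tpow w t) i.
Proof.
rewrite /contract raddf_sum.
transitivity (\sum_(j : {ffun 'I_n -> 'I_2}) \sum_(b : {ffun 'I_n -> 'I_2})
   ((\prod_m w (b m) (j m)) * t j) *: \prod_m psi (b m) (i m)).
  apply: eq_bigr => j _; rewrite /= linearZ /= rmorph_prod /=.
  under eq_bigr do rewrite alpha_psi.
  rewrite bigA_distr_bigA scaler_sumr; apply: eq_bigr => b _.
  by rewrite scaler_prod scalerA mulrC.
by rewrite exchange_big; apply: eq_bigr => b _; rewrite -scaler_suml ffunE.
Qed.

Lemma alpha_ket (w : SU2 R) (l : 'I_n.+1) i :
  alpha w (ket l i) = \sum_(k < n.+1) rho_mx n w k l *: ket k i.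
Proof.
rewrite ket_contract alpha_contract.
under [RHS]eq_bigr do rewrite ket_contract scaler_sumr.
rewrite exchange_big; apply: eq_bigr => j _.
by rewrite tpow_eT scaler_suml; apply: eq_bigr => k _; rewrite scalerA.
Qed.

Lemma alpha_star_ket (w : SU2 R) (k : 'I_n.+1) i :
  alpha w (st (ket k i)) = \sum_(l < n.+1) rho_mx n (invmx w) k l *: st (ket l i).
Proof.
rewrite alpha_star alpha_ket (star_sum (@S7starP R theta)).
by apply: eq_bigr => l _; rewrite (is_starZ (@S7starP R theta)) rho_mx_inv.
Qed.

Lemma braket_ket (k l : nat) : (k <= n)%N -> braket (ket k) (ket l) = (k == l)%:R.
Proof.
move=> kn; rewrite -(@herm_normalized R A st (@S7starP R theta) 4 n k l
  (psi 0) (psi 1)) ?herm_psi //.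
by apply: eq_bigr => i _; rewrite [ket k i]ffunE [ket l i]ffunE.
Qed.

Lemma alpha_braket (w : SU2 R) (f : tens 4 n (S4 theta)) (k : 'I_n.+1) :
  alpha w (braket (ket k) (incl f)) =
    \sum_(l < n.+1) rho_mx n (invmx w) k l *: braket (ket l) (incl f).
Proof.
rewrite /braket raddf_sum; under [RHS]eq_bigr do rewrite scaler_sumr.
rewrite exchange_big; apply: eq_bigr => i _.
have /asboolP fi := S4valP (f i).
rewrite /= rmorphM /= alpha_star_ket ffunE fi mulr_suml.
by apply: eq_bigr => l _; rewrite scalerAl.
Qed.

Lemma pn_app_braket (f : tens 4 n (S4 theta)) i :
  pn_app f i = \sum_(k < n.+1) ket k i * braket (ket k) (incl f).
Proof.
rewrite ffunE; under eq_bigr do rewrite mulr_suml.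
rewrite exchange_big; apply: eq_bigr => k _; rewrite mulr_sumr.
by apply: eq_bigr => j _; rewrite mulrA.
Qed.

(** Orthonormality lets the bras read off the right coefficients of a combination
    of kets. *)
Lemma braket_sum_ket (c : 'I_n.+1 -> A) (x : tens 4 n A) (k : 'I_n.+1) :
  (forall i, x i = \sum_(l < n.+1) ket l i * c l) -> braket (ket k) x = c k.
Proof.
move=> xc; rewrite /braket; under eq_bigr do rewrite xc mulr_sumr.
rewrite exchange_big.
rewrite (eq_bigr (fun l : 'I_n.+1 => (k == l :> nat)%:R * c l)) => [|l _].
  rewrite (bigD1 k) //= eqxx mul1r big1 ?addr0 // => l lk.
  by rewrite eq_sym (negPf (lk : l != k :> nat)) mul0r.
rewrite -(braket_ket l (ltn_ord k : (k <= n)%N)) /braket mulr_suml.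
by apply: eq_bigr => i _; rewrite mulrA.
Qed.

Lemma braket_pn_app (f : tens 4 n (S4 theta)) (k : 'I_n.+1) :
  braket (ket k) (pn_app f) = braket (ket k) (incl f).
Proof.
apply: (braket_sum_ket (c := fun l => braket (ket l) (incl f))) => i.
exact: pn_app_braket.
Qed.

End Kets.

(** * The isomorphism *)

Section Isomorphism.
Variables (R : realType) (theta : R) (n : nat).
Local Notation A := (S7 theta).
Local Notation ket := (ket theta n).
Local Notation basis := [tuple e R n i | i < n.+1].

Definition coeq_map (x : tens 4 n A) (v : V R n) : A :=
  \sum_(k < n.+1) coord basis k v *: braket (ket k) x.

Lemma coeq_map_e x (k : 'I_n.+1) : coeq_map x (e R n k) = braket (ket k) x.
Proof.
rewrite /coeq_map (bigD1 k) //= coord_e eqxx scale1r big1 ?addr0 // => l lk.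
by rewrite coord_e (negPf lk) scale0r.
Qed.

(** An element of the module of sections is some p f, and p does not change the
    pairings with the kets, so only the transformation of the pairings with the
    invariant f matters. *)
Lemma coeq_map_subproof (sigma : Gamma theta n) :
  coeq_map sigma \in @Hom_pred R theta n.
Proof.
apply/asboolP; split=> [c u v|w k].
  rewrite scaler_sumr -big_split /=; apply: eq_bigr => k _.
  by rewrite linearP scalerDl scalerA.
have /asboolP[f ->] := Gamma_valP sigma.
rewrite coeq_map_e braket_pn_app alpha_braket; apply: eq_bigr => l _.
by rewrite coeq_map_e braket_pn_app.
Qed.

Definition coeq (sigma : Gamma theta n) : Hom_rho theta n :=
  MkHom (coeq_map_subproof sigma).

Lemma coeq_linear : linear coeq.
Proof.
move=> a sigma tau; apply/val_inj/funext => v.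
transitivity (coeq_map sigma v * S4val a + coeq_map tau v); last by [].
rewrite /coeq_map mulr_suml -big_split; apply: eq_bigr => k _ /=.
rewrite -scalerAl -scalerDr; congr (_ *: _).
rewrite /braket mulr_suml -big_split; apply: eq_bigr => i _ /=.
by rewrite !ffunE mulrDr mulrA.
Qed.

HB.instance Definition _ :=
  GRing.isLinear.Build _ (Gamma theta n) (Hom_rho theta n) _ coeq coeq_linear.

(** The kets transform by rho_n(w) and the values phi(e_k) by its inverse, so the
    two matrices cancel in the sum over k. *)
Lemma coeq_inv_subproof (phi : Hom_rho theta n) i :
  \sum_(k < n.+1) ket k i * phi (e R n k) \in @S4pred R theta.
Proof.
have /asboolP[_ cphi] := Hom_valP phi.
apply/asboolP => w; rewrite raddf_sum.
transitivity (\sum_(j < n.+1) \sum_(l < n.+1) \sum_(k < n.+1)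
   (rho_mx n w j k * rho_mx n (invmx w) k l) *: (ket j i * phi (e R n l))).
  under [RHS]eq_bigr do rewrite exchange_big.
  rewrite [RHS]exchange_big; apply: eq_bigr => k _.
  rewrite /= rmorphM /= alpha_ket -cphi big_distrlr /=.
  apply: eq_bigr => j _; apply: eq_bigr => l _.
  by rewrite -scalerAl -scalerAr scalerA.
apply: eq_bigr => j _; rewrite (bigD1 j) //= -scaler_suml.
have mulE l :
    \sum_(k < n.+1) rho_mx n w j k * rho_mx n (invmx w) k l = (j == l)%:R.
  by have /matrixP/(_ j l) := rho_mx_invR n w; rewrite !mxE.
rewrite mulE eqxx scale1r big1 ?addr0 // => l lj.
by rewrite -scaler_suml mulE eq_sym (negPf lj) scale0r.
Qed.

Definition coeq_inv (phi : Hom_rho theta n) : Gamma theta n :=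
  psection [ffun i => MkS4 (coeq_inv_subproof phi i)].

Lemma braket_coeq_inv (phi : Hom_rho theta n) (k : 'I_n.+1) :
  braket (ket k) (incl [ffun i => MkS4 (coeq_inv_subproof phi i)])
    = phi (e R n k).
Proof.
apply: (braket_sum_ket (c := fun l => phi (e R n l))) => i.
by rewrite !ffunE.
Qed.

Lemma coeq_psection (f : tens 4 n (S4 theta)) (k : 'I_n.+1) :
  coeq (psection f) (e R n k) = braket (ket k) (incl f).
Proof. by rewrite [LHS]coeq_map_e braket_pn_app. Qed.

Lemma coeq_invK : cancel coeq coeq_inv.
Proof.
move=> sigma; apply/val_inj/ffunP => i; rewrite [LHS]pn_app_braket.
have /asboolP[f sf] := Gamma_valP sigma.
transitivity (pn_app f i); last by rewrite -sf.
rewrite pn_app_braket; apply: eq_bigr => k _; congr (_ * _).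
by rewrite braket_coeq_inv [LHS]coeq_map_e sf braket_pn_app.
Qed.

Lemma Hom_ext (phi phi' : Hom_rho theta n) :
  (forall k : 'I_n.+1, phi (e R n k) = phi' (e R n k)) -> phi = phi'.
Proof.
move=> eq_e; apply/val_inj/funext => v /=; rewrite (e_decomp v).
have linE (psi : Hom_rho theta n) (c : 'I_n.+1 -> R[i]) :
    psi (\sum_k c k *: e R n k) = \sum_k c k *: psi (e R n k).
  have /asboolP[lpsi _] := Hom_valP psi.
  have psi0 : psi 0 = 0.
    by have := lpsi (-1) 0 0; rewrite scaler0 addr0 scaleN1r addNr.
  elim/big_rec2: _ => // k x y _ <-; exact: lpsi.
by rewrite !linE; apply: eq_bigr => k _; rewrite eq_e.
Qed.

Lemma coeqK : cancel coeq_inv coeq.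
Proof.
by move=> phi; apply: Hom_ext => k; rewrite coeq_psection braket_coeq_inv.
Qed.

End Isomorphism.

Unset Implicit Arguments.

Theorem proposition2 (R : realType) (theta : R) (n : nat) (n_gt0 : (0 < n)%N) :
  exists Phi : {linear Gamma theta n -> Hom_rho theta n},
    bijective Phi /\
    forall (f : tens 4 n (S4 theta)) (k : 'I_n.+1),
      Phi (psection f) (e R n k) = braket (ket theta n k) (incl f).
Proof.
exists (@coeq R theta n); split; last exact: coeq_psection.
by exists (@coeq_inv R theta n); [exact: coeq_invK | exact: coeqK].
Qed.
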